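(* Let $G = (V,E)$ be a finite connected simple undirected graph with $n := |V| \geq 2$ vertices, let $X$ be the random walk on $G$, and let $\mu,\nu$ be probability distributions on $V$. Then the optimal transport time $H(\mu,\nu)$ from $\mu$ to $\nu$ using $X$ satisfies $$H(\mu,\nu) \leq n(n-1)^2 = O(n^3).$$
   Context: The random walk on $G$ is the discrete-time Markov chain on $V$ with transition probabilities $p_{i,j} = 1/d_i$ if $(i,j) \in E$ and $p_{i,j} = 0$ otherwise, where $d_i$ is the degree of vertex $i$. For probability distributions $\mu,\nu$ on the state space, the optimal transport time (also called access time) is $H(\mu,\nu) := \inf_{T} \mathbb{E}[T]$, where $X_0 \sim \mu$ and the infimum is over all almost surely finite, possibly randomized, stopping times $T$ of $X$ such that $X_T \sim \nu$. (A randomized stopping time is a stopping time with respect to a filtration $\mathcal{F}_t = \sigma(U, X_0,\dots,X_t)$, where $U$ is uniform on $[0,1]$ and independent of $X$.) *)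

(* Defs.v *)
From HB Require Import structures.
From mathcomp Require Import all_boot all_order all_algebra.
From mathcomp Require Import all_classical all_reals all_analysis.
Set Implicit Arguments.
Unset Strict Implicit.
Unset Printing Implicit Defensive.
Import Order.TTheory GRing.Theory Num.Theory.
Import numFieldNormedType.Exports.
Local Open Scope classical_set_scope.
Local Open Scope ring_scope.

Definition is_distribution (R : realType) (V : finType) (mu : V -> R) : Prop :=
  (forall v, 0 <= mu v) /\ \sum_(v : V) mu v = 1.

Definition connected_graph (V : finType) (e : rel V) : Prop :=
  forall x y : V, connect e x y.

Definition degree (V : finType) (e : rel V) (i : V) : nat := #|[pred j | e i j]|.

Definition walk_transition (R : realType) (V : finType) (e : rel V)
    (i j : V) : R :=
  if e i j then ((degree e i)%:R)^-1 else 0.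

Section processes.
Context (R : realType) (V : finType) (d : measure_display)
  (Omega : measurableType d) (P : probability Omega R).

(* Only meaningful when [P B != 0]. *)
Definition cond_prob (A B : set Omega) : R :=
  fine (P (A `&` B)) / fine (P B).

Definition history (X : nat -> Omega -> V) (t : nat) (x : nat -> V) :
    set Omega :=
  [set w | forall s : nat, (s <= t)%N -> X s w = x s].

Definition markov_chain (mu : V -> R) (p : V -> V -> R)
    (X : nat -> Omega -> V) : Prop :=
  [/\ forall t v, measurable (X t @^-1` [set v]),
      forall v, P (X 0%N @^-1` [set v]) = (mu v)%:E &
      forall (t : nat) (x : nat -> V) (y : V),
        P (history X t x) != 0%E ->
        cond_prob (X t.+1 @^-1` [set y]) (history X t x) = p (x t) y].

Definition random_walk (e : rel V) (mu : V -> R) (X : nat -> Omega -> V) :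
    Prop :=
  markov_chain mu (walk_transition R e) X.

Definition uniform01 (U : {RV P >-> R}) : Prop :=
  forall B : set R, measurable B ->
    distribution P U B = uniform_prob (@ltr01 R) B.

Definition sigma_process (X : nat -> Omega -> V) : set (set Omega) :=
  <<s [set A | exists (t : nat) (B : set V), A = X t @^-1` B] >>.

Definition independent_of_process (U : Omega -> R) (X : nat -> Omega -> V) :
    Prop :=
  forall A B : set Omega,
    g_sigma_algebra_preimage U A -> sigma_process X B ->
    P (A `&` B) = (P A * P B)%E.

(* F_t = sigma(U, X_0, ..., X_t). *)
Definition filtration (U : Omega -> R) (X : nat -> Omega -> V) (t : nat) :
    set (set Omega) :=
  <<s g_sigma_algebra_preimage U `|`
      [set A | exists (s : nat) (B : set V),
         (s <= t)%N /\ A = X s @^-1` B] >>.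

(* Random times take values in [option nat], with [None] for infinity. *)
Definition randomized_stopping_time (U : Omega -> R) (X : nat -> Omega -> V)
    (T : Omega -> option nat) : Prop :=
  forall t : nat,
    filtration U X t [set w | exists2 s : nat, T w = Some s & (s <= t)%N].

Definition as_finite (T : Omega -> option nat) : Prop :=
  {ae P, forall w, T w <> None}.

Definition stopped (X : nat -> Omega -> V) (T : Omega -> option nat)
    (w : Omega) : option V :=
  omap (fun t => X t w) (T w).

Definition stopped_law (X : nat -> Omega -> V) (T : Omega -> option nat)
    (nu : V -> R) : Prop :=
  forall v : V, P [set w | stopped X T w = Some v] = (nu v)%:E.

Definition time_value (t : option nat) : \bar R :=
  if t is Some k then (k%:R)%:E else +oo%E.

Definition expected_time (T : Omega -> option nat) : \bar R :=
  (\int[P]_w time_value (T w))%E.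

(* H(mu, nu), where mu is the law of [X 0]. *)
Definition optimal_transport_time (U : Omega -> R) (X : nat -> Omega -> V)
    (nu : V -> R) : \bar R :=
  ereal_inf [set expected_time T | T in
    [set T | [/\ randomized_stopping_time U X T, as_finite T &
                 stopped_law X T nu]]].

End processes.

(* Main.v *)
Require Import Defs.
From HB Require Import structures.
From mathcomp Require Import all_boot all_order all_algebra.
From mathcomp Require Import all_classical all_reals all_analysis.
From mathcomp Require Import measurable_realfun lra.
Set Implicit Arguments.
Unset Strict Implicit.
Unset Printing Implicit Defensive.
Import Order.TTheory GRing.Theory Num.Theory.
Import numFieldNormedType.Exports.
Local Open Scope classical_set_scope.
Local Open Scope ring_scope.

(** The upper bound is reached by a stopping time that takes no account of
    where the walk starts: draw a target vertex with law [nu] from [U], then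
    wait until the walk hits it.  The position at that time has law [nu] as soon
    as the walk hits every vertex almost surely, and by independence the mean
    waiting time is an average of mean hitting times.  It remains to bound every
    mean hitting time by [n (n - 1) ^ 2].

    Write [h v x] for the mean hitting time of [v] from [x].  Multiply the
    one-step equation [h v x = 1 + \sum_y p x y * h v y], valid for [x != v], by
    the degree of [x] and sum over [x]: the degree-weighted sums of [h v] cancel
    and leave [\sum_(y adjacent to v) h v y = D - degree v], where [D] is the
    total degree.  So a neighbour is reached in a mean time of at most [D], and
    by subadditivity of [h] along a simple path, [h v x <= (n - 1) * D], where
    [D <= n (n - 1)].

    To avoid having to know beforehand that [h] is finite, the argument is run
    on [truncated_hitting p v k x], the mean of the hitting time capped at [k],
    which is a finite recursion and increases with [k]
    ([sum_truncated_hitting_neighbours], [truncated_hitting_triangle],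
    [truncated_hitting_le]).  The probabilistic meaning of these numbers is
    given by [sum_prob_avoids], a consequence of the Markov property: the
    probabilities of not having visited [v] by time [t], summed over [t < k],
    add up to the average of [truncated_hitting p v k] over the initial law.  A
    bound on such sums, uniform in [k], bounds the expectation through the
    tail-sum formula [expected_time_tail], and also yields almost sure
    finiteness. *)

(** * Truncated hitting times *)

(** The mean, from [x], of the minimum of [k] and the hitting time of [v], for
    the chain with transition probabilities [p]. *)
Fixpoint truncated_hitting (R : realType) (V : finType) (p : V -> V -> R)
    (v : V) (k : nat) (x : V) : R :=
  if k is k'.+1 then
    if x == v then 0 else 1 + \sum_y p x y * truncated_hitting p v k' y
  else 0.

Lemma truncated_hitting_target (R : realType) (V : finType) (p : V -> V -> R)
    (v : V) (k : nat) : truncated_hitting p v k v = 0.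
Proof. by case: k => //= k; rewrite eqxx. Qed.

Section truncated_hitting.
Context (R : realType) (V : finType) (e : rel V).
Local Notation p := (walk_transition R e).
Local Notation h := (truncated_hitting p).

Lemma walk_transition_ge0 x y : 0 <= p x y.
Proof. by rewrite /walk_transition; case: ifP. Qed.

Lemma degree_walk_transition x y :
  (degree e x)%:R * p x y = (e x y)%:R.
Proof.
rewrite /walk_transition; case: ifP => [exy|_]; last by rewrite mulr0.
rewrite divff// pnatr_eq0 -lt0n; apply/card_gt0P.
by exists y; rewrite inE.
Qed.

Lemma sum_edges x : \sum_y (e x y)%:R = (degree e x)%:R :> R.
Proof.
rewrite /degree -sum1_card [in RHS]big_mkcond natr_sum.
by apply: eq_bigr => y _; rewrite inE; case: (e x y).
Qed.

(** Only an inequality, since a vertex of degree zero has no transition. *)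
Lemma sum_walk_transition_le1 x : \sum_y p x y <= 1.
Proof.
have [d0|d0] := eqVneq (degree e x) 0%N.
  rewrite big1// => y _; rewrite /walk_transition d0 invr0.
  by case: ifP.
rewrite -(@ler_pM2l _ (degree e x)%:R) ?ltr0n ?lt0n// mulr1 mulr_sumr.
by under eq_bigr do rewrite degree_walk_transition; rewrite sum_edges.
Qed.

Lemma sum_degree_le : irreflexive e ->
  \sum_x (degree e x)%:R <= #|V|%:R * (#|V|%:R - 1) :> R.
Proof.
move=> e_irr; apply: (@le_trans _ _ (\sum_(x : V) (#|V|%:R - 1))); last first.
  by rewrite sumr_const mulr_natl.
apply: ler_sum => x _.
rewrite lerBrDr natr1 ler_nat [leqRHS](cardD1 x) inE add1n ltnS.
apply: subset_leq_card; apply/fintype.subsetP => y; rewrite !inE andbT.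
by apply: contraTN => /eqP ->; rewrite e_irr.
Qed.

Lemma truncated_hitting_ge0 v k x : 0 <= h v k x.
Proof.
elim: k x => //= k IH x; case: ifP => // _.
by rewrite addr_ge0// sumr_ge0// => y _; rewrite mulr_ge0 ?walk_transition_ge0.
Qed.

Lemma truncated_hittingS_ge v k x : h v k x <= h v k.+1 x.
Proof.
elim: k x => [|k IH] x; first exact: truncated_hitting_ge0.
rewrite /=; case: ifP => // _; rewrite lerD2l.
by apply: ler_sum => y _; rewrite ler_wpM2l ?walk_transition_ge0// IH.
Qed.

(** The degree is a reversible measure, so weighting the recursion by it turns
    [\sum_y p x y * h v k y], summed over all [x], back into the weighted sum of
    [h v k].  The recursion fails only at [v], and the missing terms at [v] are
    the sum over its neighbours. *)
Lemma sum_truncated_hitting_neighbours v k : symmetric e ->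
  \sum_y (e v y)%:R * h v k y <= \sum_x (degree e x)%:R.
Proof.
move=> e_sym.
have step : \sum_x (degree e x)%:R * h v k.+1 x =
    \sum_(x | x != v) (degree e x)%:R +
    \sum_(x | x != v) \sum_y (e x y)%:R * h v k y.
  rewrite (bigD1 v)//= eqxx mulr0 add0r -big_split/=.
  apply: eq_bigr => x /negPf ->; rewrite mulrDr mulr1 mulr_sumr.
  by congr (_ + _); apply: eq_bigr => y _; rewrite mulrA degree_walk_transition.
have swap : \sum_x \sum_y (e x y)%:R * h v k y =
    \sum_y (degree e y)%:R * h v k y.
  rewrite exchange_big/=; apply: eq_bigr => y _.
  by rewrite -sum_edges mulr_suml; apply: eq_bigr => x _; rewrite e_sym.
have mono : \sum_x (degree e x)%:R * h v k x <=
    \sum_x (degree e x)%:R * h v k.+1 x.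
  by apply: ler_sum => x _; rewrite ler_wpM2l// truncated_hittingS_ge.
move: swap mono; rewrite step (bigD1 v)//= => <-.
rewrite [X in _ -> _ <= X](bigD1 v)//= => mono.
by have := ler0n R (degree e v); lra.
Qed.

Lemma truncated_hitting_adj v x k : symmetric e -> e v x ->
  h v k x <= \sum_y (degree e y)%:R.
Proof.
move=> e_sym evx; apply: le_trans (sum_truncated_hitting_neighbours v k e_sym).
rewrite (bigD1 x)//= evx mul1r lerDl sumr_ge0// => y _.
by rewrite mulr_ge0// truncated_hitting_ge0.
Qed.

(** Reaching [z] by way of [y] takes at least as long.  The bound [C] on the
    second leg has to be uniform in [k] because the time left when the chain
    reaches [y] is random. *)
Lemma truncated_hitting_triangle y z (C : R) :
  (forall k, h z k y <= C) -> forall k x, h z k x <= h y k x + C.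
Proof.
move=> hC; have C0 : 0 <= C := hC 0%N.
elim=> [|k IH] x; first by rewrite add0r.
have [->|xy] := eqVneq x y; first by rewrite truncated_hitting_target add0r.
have [->|xz] := eqVneq x z.
  by rewrite truncated_hitting_target addr_ge0// truncated_hitting_ge0.
rewrite /= (negPf xy) (negPf xz) -addrA lerD2l.
apply: (@le_trans _ _ (\sum_w (p x w * h y k w + p x w * C))).
  by apply: ler_sum => w _; rewrite -mulrDr ler_wpM2l ?walk_transition_ge0.
rewrite big_split/= lerD2l -mulr_suml ler_piMl//.
exact: sum_walk_transition_le1.
Qed.

Lemma truncated_hitting_path v q k : symmetric e -> path e v q ->
  h v k (last v q) <= (size q)%:R * \sum_y (degree e y)%:R.
Proof.
move=> e_sym; set D := \sum_y _.
elim: q v k => [|x q IH] v k /=; first by rewrite truncated_hitting_target mul0r.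
move=> /andP[evx qp].
apply: (le_trans (truncated_hitting_triangle
  (fun j => truncated_hitting_adj j e_sym evx) k (last x q))).
by rewrite -natr1 mulrDl mul1r lerD2r IH.
Qed.

Lemma truncated_hitting_le v k x : symmetric e -> irreflexive e ->
  connected_graph e -> h v k x <= #|V|%:R * (#|V|%:R - 1) ^+ 2.
Proof.
move=> e_sym e_irr /(_ v x)/connectP[q0 q0p ->].
case: (shortenP q0p) => q qp /card_uniqP qu _.
apply: (le_trans (truncated_hitting_path k e_sym qp)).
have sz : (size q)%:R <= #|V|%:R - 1 :> R.
  by rewrite lerBrDr natr1 ler_nat; have := max_card (mem (v :: q)); rewrite qu.
rewrite expr2 mulrA [leRHS]mulrC ler_pM ?sum_degree_le ?ler0n//.
by rewrite sumr_ge0// => y _; rewrite ler0n.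
Qed.

End truncated_hitting.

(** * The Markov property and avoidance probabilities *)

Section fiberwise.
Context (R : realType) (d : measure_display) (Omega : measurableType d)
  (P : probability Omega R).

Lemma prob_fin_num (A : set Omega) : measurable A -> P A \is a fin_num.
Proof. by move=> mA; rewrite fin_num_measure. Qed.

Lemma prob_fiberwise (F : finType) (Z : Omega -> F) (A : set Omega) :
  (forall f, measurable (Z @^-1` [set f])) -> measurable A ->
  fine (P A) = \sum_f fine (P (A `&` Z @^-1` [set f])).
Proof.
move=> mZ mA; have mAZ f : measurable (A `&` Z @^-1` [set f]) by exact: measurableI.
apply: EFin_inj; rewrite fineK ?prob_fin_num// -sumEFin.
under eq_bigr do rewrite fineK ?prob_fin_num//.
have {1}-> : A = \bigcup_(f in [set: F]) (A `&` Z @^-1` [set f]).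
  by apply/seteqP; split => [w Aw|w [f _ []]//]; exists (Z w).
rewrite measure_fin_bigcup//; first last.
- by move=> f g _ _ [w [[_ <-] [_ <-]]].
- exact: finite_finset.
rewrite (fsbigE (index_enum F)) ?index_enum_uniq// => [|f _].
  by apply: eq_bigl => f; rewrite in_setT.
by rewrite mem_index_enum.
Qed.

End fiberwise.

Section markov_chains.
Context (R : realType) (V : finType) (d : measure_display)
  (Omega : measurableType d) (P : probability Omega R).
Context (mu : V -> R) (p : V -> V -> R) (X : nat -> Omega -> V).
Hypothesis X_markov : markov_chain P mu p X.

Lemma measurable_state t v : measurable (X t @^-1` [set v]).
Proof. by case: X_markov. Qed.

Lemma measurable_history t x : measurable (history X t x).
Proof.
have -> : history X t x = \bigcap_(s in `I_t.+1) X s @^-1` [set x s].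
  by apply/seteqP; split => w /= H s st; apply: H.
by apply: fin_bigcap_measurable => // s _; exact: measurable_state.
Qed.

(** Multiplying out the conditional probability removes the condition that the
    history has positive probability. *)
Lemma prob_history_step t x y :
  fine (P (history X t x `&` X t.+1 @^-1` [set y])) =
  fine (P (history X t x)) * p (x t) y.
Proof.
have mH := measurable_history t x.
have [H0|H0] := eqVneq (P (history X t x)) 0%E.
  rewrite H0 mul0r (_ : P _ = 0%E)//; apply/eqP.
  rewrite -measure_le0 -H0 le_measure// inE//.
  by apply: measurableI => //; exact: measurable_state.
case: X_markov => _ _ /(_ t x y H0) <-.
rewrite /cond_prob setIC mulrC divfK// -eqe fineK//.
exact: prob_fin_num.
Qed.

(** An event determined by the first [t + 1] states is a finite disjoint union
    of histories, to each of which the one-step rule applies. *)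
Lemma markov_property t (B : set Omega) x y : measurable B ->
  (forall w w', (forall s, (s <= t)%N -> X s w = X s w') -> B w -> B w') ->
  fine (P (B `&` X t @^-1` [set x] `&` X t.+1 @^-1` [set y])) =
  fine (P (B `&` X t @^-1` [set x])) * p x y.
Proof.
move=> mB Bdet.
pose Z w : {ffun 'I_t.+1 -> V} := [ffun i => X (val i) w].
pose tr (f : {ffun 'I_t.+1 -> V}) s := f (inord s).
have ZE f : Z @^-1` [set f] = history X t (tr f).
  apply/seteqP; split => w /=.
    by move=> <- s st; rewrite /tr ffunE /= inordK.
  move=> Hw; apply/ffunP => i; rewrite ffunE (Hw i (leq_ord i)).
  by rewrite /tr inord_val.
have mZ f : measurable (Z @^-1` [set f]) by rewrite ZE; exact: measurable_history.
have mBx : measurable (B `&` X t @^-1` [set x]).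
  by apply: measurableI => //; exact: measurable_state.
rewrite (prob_fiberwise P mZ); last by apply: measurableI => //; exact: measurable_state.
rewrite (prob_fiberwise P mZ mBx) mulr_suml; apply: eq_bigr => f _.
have [[w0 [[Bw0 xw0] fw0]]|none] :=
  pselect (B `&` X t @^-1` [set x] `&` Z @^-1` [set f] !=set0).
  have trx : tr f t = x by move: fw0; rewrite ZE => /(_ t (leqnn t)) <-.
  have sub : history X t (tr f) `<=` B `&` X t @^-1` [set x].
    move=> w Hw; split; last by rewrite /= Hw.
    by apply: Bdet Bw0 => s st; move: fw0; rewrite ZE => ->//; rewrite Hw.
  by rewrite setIAC ZE (setIidr sub) prob_history_step trx.
have E0 : B `&` X t @^-1` [set x] `&` Z @^-1` [set f] = set0.
  by apply/eqP; rewrite -[_ == _]negbK; apply/negP => /set0P.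
by rewrite setIAC E0 set0I measure0 mul0r.
Qed.

Definition avoids v t := [set w | forall s, (s <= t)%N -> X s w <> v].

Lemma avoidsE v t :
  avoids v t = \bigcap_(s in `I_t.+1) ~` (X s @^-1` [set v]).
Proof. by apply/seteqP; split => w /= H s st; apply: H. Qed.

Lemma measurable_avoids v t : measurable (avoids v t).
Proof.
rewrite avoidsE.
by apply: fin_bigcap_measurable => // s _; apply: measurableC; exact: measurable_state.
Qed.

Lemma prob_avoidsS v t y : y != v ->
  fine (P (avoids v t.+1 `&` X t.+1 @^-1` [set y])) =
  \sum_x fine (P (avoids v t `&` X t @^-1` [set x])) * p x y.
Proof.
move=> yv.
(* Being at [y != v] at time [t + 1] settles avoidance at that time. *)
have -> : avoids v t.+1 `&` X t.+1 @^-1` [set y] =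
    avoids v t `&` X t.+1 @^-1` [set y].
  apply/seteqP; split => w [Aw /= yw]; split => // s.
    by move=> st; apply: Aw; exact: leqW.
  by rewrite leq_eqVlt => /predU1P[->|/Aw//]; rewrite yw; exact/eqP.
rewrite (prob_fiberwise P (measurable_state t)); last first.
  by apply: measurableI; [exact: measurable_avoids|exact: measurable_state].
apply: eq_bigr => x _; rewrite setIAC markov_property//; first exact: measurable_avoids.
by move=> w w' ww' Aw s st; rewrite -ww'//; exact: Aw.
Qed.

(** Both sides are the mean time spent before [v] is hit, during the [k] steps
    that follow time [s], counted on the event that [v] was avoided up to [s]:
    the left one by summing tails, the right one by conditioning on [X s]. *)
Lemma sum_prob_avoids v s k :
  \sum_(t < k) fine (P (avoids v (s + t))) =
  \sum_x fine (P (avoids v s `&` X s @^-1` [set x])) * truncated_hitting p v k x.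
Proof.
have mA t := measurable_avoids v t.
have at_target t : fine (P (avoids v t `&` X t @^-1` [set v])) = 0.
  rewrite (_ : _ `&` _ = set0) ?measure0//.
  by apply/seteqP; split => // w [/(_ t (leqnn t))].
elim: k s => [|k IH] s.
  by rewrite big_ord0 big1// => x _; rewrite mulr0.
rewrite big_ord_recl addn0; under eq_bigr do rewrite /= addnS -addSn.
rewrite IH (prob_fiberwise P (measurable_state s) (mA s)) [RHS](bigD1 v)//=.
rewrite (bigD1 v)//= at_target mul0r !add0r.
rewrite [X in _ + X](bigD1 v)//= at_target mul0r add0r.
rewrite [X in _ + X](_ : _ = \sum_(x | x != v)
    fine (P (avoids v s `&` X s @^-1` [set x])) *
    \sum_y p x y * truncated_hitting p v k y).
  rewrite -big_split; apply: eq_bigr => x /negPf ->.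
  by rewrite mulrDr mulr1.
under eq_bigr => y yv do rewrite prob_avoidsS// mulr_suml.
rewrite exchange_big/= (bigD1 v)//= [X in X + _]big1 ?add0r; last first.
  by move=> y _; rewrite at_target !mul0r.
apply: eq_bigr => x _; rewrite mulr_sumr [RHS](bigD1 v)//=.
rewrite truncated_hitting_target !mulr0 add0r.
by apply: eq_bigr => y _; rewrite mulrA.
Qed.

Lemma sum_prob_avoids_le v (C : R) k :
  (forall x, truncated_hitting p v k x <= C) ->
  \sum_(t < k) fine (P (avoids v t)) <= C.
Proof.
move=> hC; have C0 : 0 <= C by rewrite -(truncated_hitting_target p v k).
have := sum_prob_avoids v 0 k.
under eq_bigr do rewrite add0n.
move=> ->; apply: (@le_trans _ _
    (\sum_x fine (P (avoids v 0 `&` X 0 @^-1` [set x])) * C)).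
  by apply: ler_sum => x _; rewrite ler_wpM2l// fine_ge0.
have mA := measurable_avoids v 0.
rewrite -mulr_suml -(prob_fiberwise P (measurable_state 0) mA) ler_piMl//.
by rewrite -lee_fin fineK ?prob_fin_num// probability_le1.
Qed.

End markov_chains.

(** * Sampling a vertex from a uniform variable *)

Section quantile.
Context (R : realType).

Lemma uniform_prob_itv (a b : R) : 0 <= a -> a <= b -> b <= 1 ->
  uniform_prob (@ltr01 R) `]a, b] = (b - a)%:E.
Proof.
move=> a0 ab b1; rewrite /uniform_prob (eq_integral (fun=> 1%:E)).
  rewrite integral_cst//= mul1e lebesgue_measure_itv/= lte_fin.
  by case: ltgtP ab => // -> _; rewrite subrr.
move=> x; rewrite inE/= in_itv/= => /andP[ax xb].
rewrite /uniform_pdf subr0 invr1 (le_trans a0 (ltW ax)).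
by rewrite (le_trans xb b1).
Qed.

(** The unit interval is cut into consecutive pieces [B v] of length [nu v], in
    the order in which [V] is enumerated, and [g] is constantly [v] on [B v].
    What lies outside these pieces is sent to an arbitrary [v0]; it does not
    disturb the law, because each fibre has at least the required mass and the
    masses of the fibres add up to one. *)
Lemma distribution_quantile (V : finType) (nu : V -> R) :
  is_distribution nu ->
  exists g : R -> V, forall v, measurable (g @^-1` [set v]) /\
    uniform_prob (@ltr01 R) (g @^-1` [set v]) = (nu v)%:E.
Proof.
move=> [nu0 nu1].
have [v0 _] : exists v0 : V, true.
  apply/existsP; rewrite -[[exists _, _]]negbK; apply/negP.
  move=> /existsPn none; have /eqP := nu1.
  by rewrite big1 ?lt_eqF// => v; have := none v.
pose c (v : V) := \sum_(u | (enum_rank u < enum_rank v)%N) nu u.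
pose B (v : V) := `]c v, c v + nu v]%classic.
have cD v : c v + nu v = \sum_(u | (enum_rank u <= enum_rank v)%N) nu u.
  rewrite [RHS](bigD1 v)//= addrC; congr (_ + _); apply: eq_bigl => u.
  by rewrite ltn_neqAle andbC (inj_eq val_inj) (inj_eq enum_rank_inj).
have c0 v : 0 <= c v by rewrite sumr_ge0.
have c1 v : c v + nu v <= 1.
  rewrite cD -nu1 [leRHS](bigID (fun u => (enum_rank u <= enum_rank v)%N))/=.
  by rewrite lerDl sumr_ge0.
have c_mono u v : (enum_rank u < enum_rank v)%N -> c u + nu u <= c v.
  move=> uv; rewrite cD /c big_mkcond [leRHS]big_mkcond.
  apply: ler_sum => w _; case: ifP => [wu|_]; last by case: ifP.
  by rewrite (leq_ltn_trans wu uv).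
have Bdisj u v x : B u x -> B v x -> u = v.
  rewrite /B /= !in_itv/= => /andP[ux xu] /andP[vx xv].
  have [uv|vu|/val_inj/enum_rank_inj//] := ltngtP (enum_rank u) (enum_rank v).
    by have := lt_le_trans vx (le_trans xu (c_mono _ _ uv)); rewrite ltxx.
  by have := lt_le_trans ux (le_trans xv (c_mono _ _ vu)); rewrite ltxx.
pose g x := odflt v0 [pick v | x \in B v].
have gB v x : B v x -> g x = v.
  move=> Bx; rewrite /g; case: pickP => [u|/(_ v)] /=; last by rewrite mem_set.
  by rewrite inE => Bu; apply: Bdisj Bu Bx.
have mB v : measurable (B v) by exact: measurable_itv.
have gE v : g @^-1` [set v] =
    B v `|` ([set _ | v = v0] `&` ~` (\bigcup_(u in [set: V]) B u)).
  apply/seteqP; split => [x /=|x [/gB//|[/= -> nB]]].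
    rewrite /g; case: pickP => [u /= /set_mem Bu <-|none /= <-]; first by left.
    by right; split => // -[u _ Bu]; have := none u; rewrite mem_set.
  rewrite /g; case: pickP => //= u; rewrite inE => Bu.
  by exfalso; apply: nB; exists u.
have mg v : measurable (g @^-1` [set v]).
  rewrite gE; apply: measurableU => //; apply: measurableI.
    have [->|nv] := pselect (v = v0).
      by rewrite (_ : [set _ | _] = setT)//; apply/seteqP; split.
    by rewrite (_ : [set _ | _] = set0)//; apply/seteqP; split.
  by apply: measurableC; apply: fin_bigcup_measurable => //; exact: finite_finset.
exists g => v; split=> //; pose Q := uniform_prob (@ltr01 R) : probability _ _.
have Qge u : nu u <= fine (Q (g @^-1` [set u])).
  rewrite -lee_fin fineK; last by apply: prob_fin_num; exact: mg.
  have -> : (nu u)%:E = Q (B u).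
    by rewrite /Q/= uniform_prob_itv ?c0 ?c1 ?lerDl// addrC addKr.
  by apply: le_measure => [||x /gB]; rewrite ?inE; [exact: mB|exact: mg|].
have Qsum : \sum_u (fine (Q (g @^-1` [set u])) - nu u) = 0.
  rewrite big_split/= sumrN nu1; apply/eqP; rewrite subr_eq0; apply/eqP.
  transitivity (fine (Q setT)); last by rewrite probability_setT.
  rewrite (prob_fiberwise Q mg measurableT).
  by apply: eq_bigr => w _; rewrite setTI.
have /eqP : fine (Q (g @^-1` [set v])) - nu v = 0.
  by apply: (psumr_eq0P _ Qsum) => // w _; rewrite subr_ge0.
by rewrite subr_eq0 => /eqP <-; rewrite fineK//; apply: prob_fin_num; exact: mg.
Qed.

End quantile.

(** * Expectations of extended random times *)

Section stopping_times.
Context (R : realType) (d : measure_display)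
  (Omega : measurableType d) (P : probability Omega R).

Lemma filtration_measurable (V : finType) (U : {RV P >-> R}) (X : nat -> Omega -> V) t A :
  (forall s v, measurable (X s @^-1` [set v])) ->
  filtration U X t A -> measurable A.
Proof.
move=> mX; apply: smallest_sub; first exact: sigma_algebra_measurable.
move=> _ [[B mB <-]|[s [B [_ ->]]]]; first exact: measurable_funP.
have -> : X s @^-1` B = \bigcup_(v in B) X s @^-1` [set v].
  apply/seteqP; split => [w Bw|w [v Bv vw]]; first by exists (X s w).
  by rewrite /preimage/= vw.
by apply: fin_bigcup_measurable => //; exact: finite_finset.
Qed.

Definition stopped_by (T : Omega -> option nat) t :=
  [set w | exists2 s, T w = Some s & (s <= t)%N].

Lemma time_value_tail (T : Omega -> option nat) w :
  time_value R (T w) =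
  (\sum_(t <oo) (\1_(~` stopped_by T t) w)%:E)%E.
Proof.
have ind t : \1_(~` stopped_by T t) w =
    (if T w is Some k then (t < k)%N else true)%:R :> R.
  rewrite indicE; congr (_%:R).
  case E : (T w) => [k|]; last first.
    by apply: congr1; apply/mem_set => -[s]; rewrite E.
  apply: congr1; apply/idP/idP => [/set_mem nT|tk].
    by rewrite ltnNge; apply/negP => kt; apply: nT; exists k.
  by apply/mem_set => -[s]; rewrite E => -[<-]; rewrite leqNgt tk.
under eq_eseriesr do rewrite ind.
case: (T w) => [k|] /=.
  rewrite (@nneseries_split _ _ 0 k) ?add0n; last by move=> *; rewrite lee_fin.
  rewrite [X in (_ + X)%E]eseries0 ?adde0; last first.
    by move=> t kt _; rewrite ltnNge kt.
  rewrite sumEFin; congr EFin.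
  under eq_big_nat => t tk do rewrite (andP tk).2.
  by rewrite big_const_nat subn0 iter_addr_0.
(* Never stopped: all terms are 1, and the partial sums exceed any [r]. *)
apply/esym/eq_infty => r; apply: (@le_trans _ _ (\sum_(0 <= t < `|Num.ceil r|%N) 1)%E).
  rewrite sumEFin big_const_nat subn0 iter_addr_0 lee_fin.
  apply: (le_trans (Num.Theory.ceil_ge r)).
  by rewrite natr_absz ler_int ler_norm.
exact: nneseries_lim_ge.
Qed.

Lemma measurable_tail_fun (T : Omega -> option nat) t :
  measurable (stopped_by T t) ->
  measurable_fun setT (fun w => (\1_(~` stopped_by T t) w)%:E : \bar R).
Proof.
by move=> mT; apply/measurable_EFinP/measurable_indic/measurableC.
Qed.

Lemma expected_time_tail (T : Omega -> option nat) :
  (forall t, measurable (stopped_by T t)) ->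
  expected_time P T = (\sum_(t <oo) P (~` stopped_by T t))%E.
Proof.
move=> mT; rewrite /expected_time.
under eq_integral do rewrite time_value_tail.
rewrite integral_nneseries//; last by move=> t; exact: measurable_tail_fun.
apply: eq_eseriesr => t _.
by rewrite integral_indic// ?setIT//; exact: measurableC.
Qed.

Lemma expected_time_le (T : Omega -> option nat) (C : R) :
  (forall t, measurable (stopped_by T t)) ->
  (forall k, \sum_(t < k) fine (P (~` stopped_by T t)) <= C) ->
  (expected_time P T <= C%:E)%E.
Proof.
move=> mT hC; rewrite expected_time_tail//; apply: lime_le.
  by apply: is_cvg_nneseries => t _ _; exact: measure_ge0.
apply: nearW => k; rewrite big_mkord; apply: le_trans (_ : (_ <= C%:E)%E) => //.
have := hC k; rewrite -lee_fin -sumEFin; apply: le_trans.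
by rewrite lee_sum// => t _; rewrite fineK// prob_fin_num//; exact: measurableC.
Qed.

(** The value [None] counts as infinity, and an integrable function is almost
    everywhere finite. *)
Lemma finite_expectation_as_finite (T : Omega -> option nat) :
  (forall t, measurable (stopped_by T t)) ->
  (expected_time P T < +oo)%E -> as_finite P T.
Proof.
move=> mT Tfin.
have iT : P.-integrable setT (fun w => time_value R (T w)).
  apply/integrableP; split.
    under eq_fun do rewrite time_value_tail.
    apply: (@ge0_emeasurable_sum _ _ _ setT
      (fun t w => (\1_(~` stopped_by T t) w)%:E : \bar R) predT).
      by move=> t w _ _; rewrite lee_fin.
    by move=> t _; exact: measurable_tail_fun.
  rewrite (eq_integral (fun w => time_value R (T w)))// => w _.
  by rewrite gee0_abs//; case: (T w) => //= k; rewrite lee_fin.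
have := integrable_ae measurableT iT.
by apply: filterS => w /(_ I) + E; rewrite E.
Qed.

End stopping_times.

(** * Hitting times of a random target *)

Section hitting_times.
Context (V : finType).

Definition hitting_time (f : nat -> V) (v : V) : option nat :=
  if pselect (exists t, f t == v) is left ex then Some (ex_minn ex) else None.

Lemma hitting_time_hits f v t : hitting_time f v = Some t -> f t = v.
Proof.
rewrite /hitting_time; case: pselect => // ex [<-].
by case: ex_minnP => m /eqP.
Qed.

Lemma hitting_time_le f v t :
  (exists2 s, hitting_time f v = Some s & (s <= t)%N) <->
  (exists2 s, (s <= t)%N & f s = v).
Proof.
split=> [[s /hitting_time_hits fs st]|[s st fs]]; first by exists s.
rewrite /hitting_time; case: pselect => [ex|[]]; last by exists s; apply/eqP.
exists (ex_minn ex) => //; case: ex_minnP => m _ /(_ s) ms.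
by apply: leq_trans st; apply: ms; apply/eqP.
Qed.

Context (d : measure_display) (Omega : measurableType d)
  (X : nat -> Omega -> V).

Definition random_hitting_time (W : Omega -> V) (w : Omega) : option nat :=
  hitting_time (X^~ w) (W w).

Lemma stopped_by_hitting W t :
  stopped_by (random_hitting_time W) t =
  \bigcup_(v in [set: V]) (W @^-1` [set v] `&` ~` avoids X v t).
Proof.
apply/seteqP; split => [w /hitting_time_le[s st Xs]|w [v _ [/= Wv nav]]].
  by exists (W w) => //; split => // /(_ s st).
apply/hitting_time_le; apply: contrapT => H; apply: nav => s st Xs.
by apply: H; exists s; rewrite // Xs.
Qed.

(** On the event that the target is [v], still running at time [t] is an event
    about the chain alone, to which independence of the target applies. *)
Lemma tail_hitting_fiber W t v :
  ~` stopped_by (random_hitting_time W) t `&` W @^-1` [set v] =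
  W @^-1` [set v] `&` avoids X v t.
Proof.
rewrite stopped_by_hitting; apply/seteqP; split => w.
  move=> [nT Wv]; split => //; apply: contrapT => nav.
  by apply: nT; exists v.
by move=> [<- av]; split => // -[u _ [<-]].
Qed.

Lemma sigma_process_avoids v t : sigma_process X (avoids X v t).
Proof.
rewrite avoidsE /sigma_process; set G := [set A | _].
apply: (@fin_bigcap_measurable _ (g_sigma_algebraType G)) => // s _.
by apply: measurableC; apply: sub_sigma_algebra; exists s, [set v].
Qed.

Lemma randomized_stopping_hitting (R : realType) (U : Omega -> R) (g : R -> V) :
  (forall v, measurable (g @^-1` [set v])) ->
  randomized_stopping_time U X (random_hitting_time (g \o U)).
Proof.
move=> mg t; rewrite /filtration; set G := _ `|` _.
rewrite -[[set w | _]]/(stopped_by (random_hitting_time (g \o U)) t).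
rewrite stopped_by_hitting.
apply: (@fin_bigcup_measurable _ (g_sigma_algebraType G)).
  exact: finite_finset.
move=> v _; apply: measurableI.
  apply: sub_sigma_algebra; left; exists (g @^-1` [set v]) => //.
  by rewrite setTI.
rewrite avoidsE; apply: measurableC; apply: fin_bigcap_measurable => // s st.
by apply: measurableC; apply: sub_sigma_algebra; right; exists s, [set v].
Qed.

End hitting_times.

(** * Bounding the optimal transport time *)

Section optimal_transport.
Context (R : realType) (V : finType) (d : measure_display)
  (Omega : measurableType d) (P : probability Omega R).
Context (mu nu : V -> R) (p : V -> V -> R) (X : nat -> Omega -> V).
Hypotheses (nu_distr : is_distribution nu) (X_markov : markov_chain P mu p X).
Context (U : {RV P >-> R}).
Hypotheses (U_unif : uniform01 U) (U_indep : independent_of_process P U X).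

(** The competitor in the infimum is the hitting time of a target with law [nu]
    that is independent of the chain: its mean is the [nu]-average of mean
    hitting times, so no fixed target takes longer than [C] on average. *)
Lemma optimal_transport_time_le (C : R) :
  (forall v k x, truncated_hitting p v k x <= C) ->
  (optimal_transport_time P U X nu <= C%:E)%E.
Proof.
move=> hC; have [g gP] := distribution_quantile nu_distr.
have mg v : measurable (g @^-1` [set v]) by have [] := gP v.
pose W := g \o U; pose T := random_hitting_time X W.
have mX := measurable_state X_markov.
have mA := measurable_avoids X_markov.
have mW v : measurable (W @^-1` [set v]).
  by rewrite /W comp_preimage -[X in measurable X]setTI; exact: measurable_funP.
have T_stop : randomized_stopping_time U X T by exact: randomized_stopping_hitting.
have mT t : measurable (stopped_by T t) by exact: filtration_measurable mX (T_stop t).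
have PW v : P (W @^-1` [set v]) = (nu v)%:E.
  by have [mgv <-] := gP v; rewrite -U_unif.
have PWA v t : fine (P (W @^-1` [set v] `&` avoids X v t)) =
    nu v * fine (P (avoids X v t)).
  rewrite U_indep; last exact: sigma_process_avoids.
    by rewrite fineM ?prob_fin_num// PW.
  by exists (g @^-1` [set v]) => //; rewrite setTI.
have ET : (expected_time P T <= C%:E)%E.
  apply: expected_time_le => // k.
  under eq_bigr => t _.
    rewrite (prob_fiberwise P mW) ?measurableC//; last exact: measurableC.
    under eq_bigr do rewrite tail_hitting_fiber PWA.
    over.
  rewrite exchange_big/=; apply: (@le_trans _ _ (\sum_v nu v * C)).
    case: nu_distr => nu0 _; apply: ler_sum => v _.
    by rewrite -mulr_sumr ler_wpM2l// (sum_prob_avoids_le X_markov).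
  by rewrite -mulr_suml; case: nu_distr => _ ->; rewrite mul1r.
have T_fin : as_finite P T.
  by apply: finite_expectation_as_finite => //; apply: le_lt_trans ET _; rewrite ltry.
apply: ereal_inf_le; exists (expected_time P T) => //.
exists T => //; split=> // v.
have mfin : measurable [set w | T w <> None].
  have -> : [set w | T w <> None] = \bigcup_t stopped_by T t.
    apply/seteqP; split => [w /=|w [t _ [s Ts _]] /=]; last by rewrite Ts.
    by case E : (T w) => [k|]// _; exists k => //; exists k.
  by apply: bigcup_measurable => t _.
(* Once stopped, the chain is at its target. *)
have -> : [set w | stopped X T w = Some v] = W @^-1` [set v] `&` [set w | T w <> None].
  apply/seteqP; split => w; rewrite /stopped /=.
    case E : (T w) => [k|]//= [Xk]; split => //.
    by move: E => /hitting_time_hits; rewrite Xk.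
  by move=> [<-]; case E : (T w) => [k|]//= _; rewrite (hitting_time_hits E).
set F := [set w | T w <> None].
have mWF : measurable (W @^-1` [set v] `&` F) by exact: measurableI.
have mFC : measurable (~` F) by exact: measurableC.
have mWFC : measurable (W @^-1` [set v] `&` ~` F) by exact: measurableI.
have PFC : P (~` F) = 0%E by apply: measure_negligible.
have PWFC : P (W @^-1` [set v] `&` ~` F) = 0%E.
  by apply/eqP; rewrite -measure_le0 -PFC le_measure// inE.
have -> : (nu v)%:E = P (W @^-1` [set v] `&` F `|` W @^-1` [set v] `&` ~` F).
  by rewrite -setIUr setUv setIT PW.
have disj : W @^-1` [set v] `&` F `&` (W @^-1` [set v] `&` ~` F) = set0.
  by rewrite setIACA setICr setI0.
transitivity (P (W @^-1` [set v] `&` F) + P (W @^-1` [set v] `&` ~` F))%E.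
  by rewrite PWFC adde0.
exact/esym/measureU.
Qed.

End optimal_transport.

Theorem corollary2p2 (R : realType) (V : finType) (e : rel V)
    (e_sym : symmetric e) (e_irr : irreflexive e)
    (e_conn : connected_graph e) (V_ge2 : (2 <= #|V|)%N)
    (mu nu : V -> R) (mu_distr : is_distribution mu)
    (nu_distr : is_distribution nu)
    (d : measure_display) (Omega : measurableType d)
    (P : probability Omega R)
    (X : nat -> Omega -> V) (X_walk : random_walk P e mu X)
    (U : {RV P >-> R}) (U_unif : uniform01 U)
    (U_indep : independent_of_process P U X) :
  (optimal_transport_time P U X nu
     <= (#|V|%:R * (#|V|%:R - 1) ^+ 2 : R)%:E)%E /\
  (fun n : nat => n%:R * (n%:R - 1) ^+ 2 : R) =O_\oo
    (fun n : nat => n%:R ^+ 3 : R).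
Proof.
split.
  apply: (optimal_transport_time_le nu_distr X_walk U_unif U_indep) => v k x.
  exact: truncated_hitting_le.
apply/eqOP/bigO_exP; exists 1 => //.
apply: nearW => -[|n]; first by rewrite mul0r normr0 mul1r.
rewrite mul1r -natr1 addrK (exprS _ 2).
rewrite !ger0_norm ?mulr_ge0 ?exprn_ge0 ?addr_ge0//.
by rewrite ler_wpM2l ?addr_ge0// lerXn2r ?nnegrE ?addr_ge0// lerDl.
Qed.
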